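(* Let $\mathbb{F}$ be a field, $0\ne q\in\mathbb{F}$ not a root of unity, $n\ge 2$. Let $\lambda$ be a partition into not more than $n$ parts, and suppose that $\alpha_j^\vee(\lambda)=\lambda_j-\lambda_{j+1}\neq0$ for all $j=1,\dots,n-1$. For $2\le m\le n$ and $1\le j\le m-1$ put $\xi_m^\lambda(v_j)=\Psi_{m-j}^{+(j-1)}\in U_q^-(\mathfrak{gl}_n)$, where the $\Psi$'s are formed with respect to $\lambda$ (see the context). (a) The union of the sets $\{\xi_m^\lambda(v_j)\mid1\le j\le m-1\}$, as $m$ runs from $2$ to $n$, is a set of linearly independent negative root vectors in $U_q^-(\mathfrak{gl}_n)$, in bijection with the set of negative roots ($\xi_m^\lambda(v_j)$ being of weight $-(\alpha_j+\cdots+\alpha_{m-1})$), and each such vector is a linear combination of (shifted) Coxeter monomials. (b) If $b$ is a maximal vector of weight $\lambda$ in some $U_q(\mathfrak{gl}_n)$-module, generating a copy of $V_q(\lambda)$, then the union, as $m$ runs from $2$ to $n$, of the sets $\{\xi_m^\lambda(v_j)b\mid1\le j\le m-1,\ \xi_m^\lambda(v_j)b\neq0\}$ is a set of linearly independent vectors in $V_q(\lambda)$, in bijection (by taking weights) with a subset of $\{\lambda-\alpha\mid\alpha\in\mathcal{R}^+\}$, where $\mathcal{R}^+=\{\alpha_i+\cdots+\alpha_j\mid1\le i\le j\le n-1\}$ is the set of positive roots.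
   Context: Notation: $[m]=(q^m-q^{-m})/(q-q^{-1})$ for $m\in\mathbb{Z}$; $\varepsilon_i$ is the $i$th standard basis vector of $\mathbb{Z}^n$ and $\alpha_i=\varepsilon_i-\varepsilon_{i+1}$. **Algebra.** $U_q(\mathfrak{gl}_n)$ is the $\mathbb{F}$-algebra with generators $E_i,F_i$ ($1\le i\le n-1$), $K_i^{\pm1}$ ($1\le i\le n$) and relations: $K_iK_j=K_jK_i$, $K_iK_i^{-1}=1=K_i^{-1}K_i$; $E_iF_j-F_jE_i=\delta_{ij}\frac{\tilde K_i-\tilde K_i^{-1}}{q-q^{-1}}$ with $\tilde K_i=K_iK_{i+1}^{-1}$; $K_iE_j=q^{\delta_{i,j}-\delta_{i,j+1}}E_jK_i$, $K_iF_j=q^{-(\delta_{i,j}-\delta_{i,j+1})}F_jK_i$; $E_i^2E_j-(q+q^{-1})E_iE_jE_i+E_jE_i^2=0$ if $|i-j|=1$, $E_iE_j=E_jE_i$ if $|i-j|>1$; and the same two relations with every $E$ replaced by $F$. $U_q^-(\mathfrak{gl}_n)$ is the subalgebra generated by the $F_i$. An element $x\in U_q^-(\mathfrak{gl}_n)$ has weight $\beta=\sum_i\beta_i\varepsilon_i$ if $K_ixK_i^{-1}=q^{\beta_i}x$ for all $i$; a negative root vector is a nonzero element whose weight is a negative root $-(\alpha_i+\cdots+\alpha_j)$, $1\le i\le j\le n-1$. Modules are finite dimensional and direct sums of weight spaces $\{v:K_iv=q^{\mu_i}v\text{ for all } i\}$, $\mu\in\mathbb{Z}^n$. A maximal vector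 of weight $\lambda$ is a nonzero vector of weight $\lambda$ killed by all $E_i$. $V_q(\lambda)$ is the simple module of highest weight $\lambda$. A Coxeter monomial is a product of $F_1,\dots,F_k$ (for some $k$), each occurring exactly once, in some order. A shifted Coxeter monomial is obtained from one by replacing each $F_i$ by $F_{i+s}$ for some fixed $s\ge0$. **The elements $\Psi_j$.** Extend $\lambda$ by zeros. Set $c_1=0$, $c_m=\lambda_2-\lambda_{m+1}+m-1$ ($m\ge2$), $d_m=\lambda_1-\lambda_{m+1}+m-1$ ($m\ge1$). Define $\Psi_0=1$, $\Psi_1=F_1/[d_1]$ and $\Psi_m=\frac1{[d_m]}\big([c_m]F_1\Psi_{m-1}^+-[c_m-1]\Psi_{m-1}^+F_1\big)$ for $m\ge2$. Here the superscript $+$ replaces each $F_i$ by $F_{i+1}$ and each $\alpha_i$ by $\alpha_{i+1}$ (i.e. each $\lambda_i$ by $\lambda_{i+1}$), and $+(k)$ means shifting $k$ times. *)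

(* Defs.v *)
From HB Require Import structures.
From mathcomp Require Import all_boot all_order all_algebra.
From mathcomp Require Import ring_quotient generic_quotient finmap monalg.
From mathcomp Require Import boolp classical_sets.

Set Implicit Arguments.
Unset Strict Implicit.
Unset Printing Implicit Defensive.
Import Order.TTheory GRing.Theory Num.Theory.
Local Open Scope ring_scope.
Local Open Scope quotient_scope.

Definition qnum (F : fieldType) (q : F) (m : int) : F :=
  (q ^ m - q ^ (- m)) / (q - q^-1).

Inductive uq_gen (n : nat) : Type :=
  | gE of 'I_n.-1 | gF of 'I_n.-1 | gK of 'I_n | gKinv of 'I_n.

Section UqGenChoice.
Variable n : nat.

Definition uq_gen_code (g : uq_gen n) : bool * 'I_n.-1 + bool * 'I_n :=
  match g with
  | gE i => inl (true, i) | gF i => inl (false, i)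
  | gK i => inr (true, i) | gKinv i => inr (false, i)
  end.

Definition uq_gen_decode (c : bool * 'I_n.-1 + bool * 'I_n) : uq_gen n :=
  match c with
  | inl (b, i) => if b then gE i else gF i
  | inr (b, i) => if b then gK i else gKinv i
  end.

Lemma uq_gen_codeK : cancel uq_gen_code uq_gen_decode.
Proof. by case. Qed.

HB.instance Definition _ := Choice.copy (uq_gen n) (can_type uq_gen_codeK).

End UqGenChoice.

(* [uq_rel q E Fn K Ki r] : r = 0 is one of the defining relations, written for
   E = (E_i), Fn = (F_i), K = (K_i), Ki = (K_i^-1).  Ordinals are 0-based:
   k : 'I_n stands for the index k+1 in 1..n, and i : 'I_n.-1 for the index
   i+1 in 1..n-1. *)
Inductive uq_rel (F : fieldType) (q : F) (n : nat) (A : lalgType F)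
    (E Fn : 'I_n.-1 -> A) (K Ki : 'I_n -> A) : A -> Prop :=
  | uq_KK (i j : 'I_n) : uq_rel q E Fn K Ki (K i * K j - K j * K i)
  | uq_KKinv (i : 'I_n) : uq_rel q E Fn K Ki (K i * Ki i - 1)
  | uq_KinvK (i : 'I_n) : uq_rel q E Fn K Ki (Ki i * K i - 1)
  | uq_EF (i j : 'I_n.-1) (k l : 'I_n) of k = i :> nat & l = i.+1 :> nat :
      uq_rel q E Fn K Ki
        (E i * Fn j - Fn j * E i
         - ((i == j)%:R / (q - q^-1)) *: (K k * Ki l - K l * Ki k))
  | uq_KE (i : 'I_n) (j : 'I_n.-1) :
      uq_rel q E Fn K Ki
        (K i * E j
         - q ^ ((i == j :> nat)%:Z - (i == j.+1 :> nat)%:Z) *: (E j * K i))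
  | uq_KF (i : 'I_n) (j : 'I_n.-1) :
      uq_rel q E Fn K Ki
        (K i * Fn j
         - q ^ (- ((i == j :> nat)%:Z - (i == j.+1 :> nat)%:Z)) *: (Fn j * K i))
  | uq_serreE (i j : 'I_n.-1) of (i == j.+1 :> nat) || (j == i.+1 :> nat) :
      uq_rel q E Fn K Ki
        (E i ^+ 2 * E j - (q + q^-1) *: (E i * E j * E i) + E j * E i ^+ 2)
  | uq_commE (i j : 'I_n.-1) of (i.+1 < j)%N || (j.+1 < i)%N :
      uq_rel q E Fn K Ki (E i * E j - E j * E i)
  | uq_serreF (i j : 'I_n.-1) of (i == j.+1 :> nat) || (j == i.+1 :> nat) :
      uq_rel q E Fn K Ki
        (Fn i ^+ 2 * Fn j - (q + q^-1) *: (Fn i * Fn j * Fn i)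
         + Fn j * Fn i ^+ 2)
  | uq_commF (i j : 'I_n.-1) of (i.+1 < j)%N || (j.+1 < i)%N :
      uq_rel q E Fn K Ki (Fn i * Fn j - Fn j * Fn i).

Lemma uq_rel_morph (F : fieldType) (q : F) (n : nat) (A B : lalgType F)
    (phi : {lrmorphism A -> B}) (E Fn : 'I_n.-1 -> A) (K Ki : 'I_n -> A)
    (E' Fn' : 'I_n.-1 -> B) (K' Ki' : 'I_n -> B) :
  phi \o E =1 E' -> phi \o Fn =1 Fn' -> phi \o K =1 K' -> phi \o Ki =1 Ki' ->
  forall r, uq_rel q E Fn K Ki r -> uq_rel q E' Fn' K' Ki' (phi r).
Proof.
move=> hE hF hK hKi r hr.
have {}hE i : phi (E i) = E' i by apply: hE.
have {}hF i : phi (Fn i) = Fn' i by apply: hF.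
have {}hK i : phi (K i) = K' i by apply: hK.
have {}hKi i : phi (Ki i) = Ki' i by apply: hKi.
have hZ c x : phi (c *: x) = c *: phi x by exact: linearZ.
case: hr => *;
  rewrite ?(rmorphB, rmorphD, hZ, rmorphXn, rmorphM, rmorph1) /=
    ?(rmorphB, hZ, rmorphXn, rmorphM) /= ?(hE, hF, hK, hKi).
exact: (@uq_KK F q n B E' Fn' K' Ki').
exact: (@uq_KKinv F q n B E' Fn' K' Ki').
exact: (@uq_KinvK F q n B E' Fn' K' Ki').
exact: (@uq_EF F q n B E' Fn' K' Ki').
exact: (@uq_KE F q n B E' Fn' K' Ki').
exact: (@uq_KF F q n B E' Fn' K' Ki').
exact: (@uq_serreE F q n B E' Fn' K' Ki').
exact: (@uq_commE F q n B E' Fn' K' Ki').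
exact: (@uq_serreF F q n B E' Fn' K' Ki').
exact: (@uq_commF F q n B E' Fn' K' Ki').
Qed.

Lemma uq_rel_preim (F : fieldType) (q : F) (n : nat) (A B : lalgType F)
    (phi : {lrmorphism A -> B}) (E Fn : 'I_n.-1 -> A) (K Ki : 'I_n -> A)
    (E' Fn' : 'I_n.-1 -> B) (K' Ki' : 'I_n -> B) :
  phi \o E =1 E' -> phi \o Fn =1 Fn' -> phi \o K =1 K' -> phi \o Ki =1 Ki' ->
  forall r, uq_rel q E' Fn' K' Ki' r ->
  exists2 r0, uq_rel q E Fn K Ki r0 & r = phi r0.
Proof.
move=> hE hF hK hKi r hr.
have {}hE i : phi (E i) = E' i by apply: hE.
have {}hF i : phi (Fn i) = Fn' i by apply: hF.
have {}hK i : phi (K i) = K' i by apply: hK.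
have {}hKi i : phi (Ki i) = Ki' i by apply: hKi.
have hZ c x : phi (c *: x) = c *: phi x by exact: linearZ.
case: hr => [i j|i|i|i j k l hk hl|i j|i j|i j hij|i j hij|i j hij|i j hij].
- apply: (ex_intro2 _ _ _ (@uq_KK F q n A E Fn K Ki i j)).
  by rewrite ?(rmorphB, rmorphD, hZ, rmorphXn, rmorphM, rmorph1) /=
    ?(rmorphB, hZ, rmorphXn, rmorphM) /= ?(hE, hF, hK, hKi).
- apply: (ex_intro2 _ _ _ (@uq_KKinv F q n A E Fn K Ki i)).
  by rewrite ?(rmorphB, rmorphD, hZ, rmorphXn, rmorphM, rmorph1) /=
    ?(rmorphB, hZ, rmorphXn, rmorphM) /= ?(hE, hF, hK, hKi).
- apply: (ex_intro2 _ _ _ (@uq_KinvK F q n A E Fn K Ki i)).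
  by rewrite ?(rmorphB, rmorphD, hZ, rmorphXn, rmorphM, rmorph1) /=
    ?(rmorphB, hZ, rmorphXn, rmorphM) /= ?(hE, hF, hK, hKi).
- apply: (ex_intro2 _ _ _ (@uq_EF F q n A E Fn K Ki i j k l hk hl)).
  by rewrite ?(rmorphB, rmorphD, hZ, rmorphXn, rmorphM, rmorph1) /=
    ?(rmorphB, hZ, rmorphXn, rmorphM) /= ?(hE, hF, hK, hKi).
- apply: (ex_intro2 _ _ _ (@uq_KE F q n A E Fn K Ki i j)).
  by rewrite ?(rmorphB, rmorphD, hZ, rmorphXn, rmorphM, rmorph1) /=
    ?(rmorphB, hZ, rmorphXn, rmorphM) /= ?(hE, hF, hK, hKi).
- apply: (ex_intro2 _ _ _ (@uq_KF F q n A E Fn K Ki i j)).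
  by rewrite ?(rmorphB, rmorphD, hZ, rmorphXn, rmorphM, rmorph1) /=
    ?(rmorphB, hZ, rmorphXn, rmorphM) /= ?(hE, hF, hK, hKi).
- apply: (ex_intro2 _ _ _ (@uq_serreE F q n A E Fn K Ki i j hij)).
  by rewrite ?(rmorphB, rmorphD, hZ, rmorphXn, rmorphM, rmorph1) /=
    ?(rmorphB, hZ, rmorphXn, rmorphM) /= ?(hE, hF, hK, hKi).
- apply: (ex_intro2 _ _ _ (@uq_commE F q n A E Fn K Ki i j hij)).
  by rewrite ?(rmorphB, rmorphD, hZ, rmorphXn, rmorphM, rmorph1) /=
    ?(rmorphB, hZ, rmorphXn, rmorphM) /= ?(hE, hF, hK, hKi).
- apply: (ex_intro2 _ _ _ (@uq_serreF F q n A E Fn K Ki i j hij)).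
  by rewrite ?(rmorphB, rmorphD, hZ, rmorphXn, rmorphM, rmorph1) /=
    ?(rmorphB, hZ, rmorphXn, rmorphM) /= ?(hE, hF, hK, hKi).
- apply: (ex_intro2 _ _ _ (@uq_commF F q n A E Fn K Ki i j hij)).
  by rewrite ?(rmorphB, rmorphD, hZ, rmorphXn, rmorphM, rmorph1) /=
    ?(rmorphB, hZ, rmorphXn, rmorphM) /= ?(hE, hF, hK, hKi).
Qed.

Lemma uq_rel_trivial (F : fieldType) (q : F) (n : nat) (A : lalgType F) r :
  @uq_rel F q n A (fun=> 0) (fun=> 0) (fun=> 1) (fun=> 1) r -> r = 0.
Proof.
by case=> *; rewrite ?expr2 ?(mulr0, mul0r, mulr1, scaler0, subrr, subr0, addr0).
Qed.

Section QuotientByRelations.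
Variables (F : fieldType) (A : lalgType F) (rel : A -> Prop).

(* The two-sided ideal generated by the elements satisfying [rel]. *)
Definition in_ideal (x : A) : Prop :=
  exists2 s : seq (A * A * A), (forall t, t \in s -> rel t.1.2) &
    x = \sum_(t <- s) t.1.1 * t.1.2 * t.2.

Definition rel_ideal : pred A := fun x => `[< in_ideal x >].

Lemma rel_idealP x : reflect (in_ideal x) (x \in rel_ideal).
Proof. by rewrite unfold_in; apply: asboolP. Qed.

Lemma in_ideal_rel x : rel x -> in_ideal x.
Proof.
move=> hx; exists [:: (1, x, 1)]; last by rewrite big_seq1 mul1r mulr1.
by move=> t; rewrite inE => /eqP ->.
Qed.

Lemma in_ideal0 : in_ideal 0.
Proof. by exists [::]; rewrite ?big_nil. Qed.

Lemma in_idealD x y : in_ideal x -> in_ideal y -> in_ideal (x + y).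
Proof.
move=> [s hs ->] [s' hs' ->]; exists (s ++ s'); rewrite ?big_cat // => t.
by rewrite mem_cat => /orP[/hs|/hs'].
Qed.

Lemma in_idealM a b x : in_ideal x -> in_ideal (a * x * b).
Proof.
move=> [s hs ->]; exists [seq (a * t.1.1, t.1.2, t.2 * b) | t <- s].
  by move=> _ /mapP[t /hs ht ->].
rewrite big_map mulr_sumr mulr_suml; apply: eq_bigr => t _ /=.
by rewrite !mulrA.
Qed.

Lemma in_idealZ c x : in_ideal x -> in_ideal (c *: x).
Proof. by move=> /(in_idealM (c *: 1) 1); rewrite mulr1 -scalerAl mul1r. Qed.

Lemma rel_ideal_zmod_closed : zmod_closed rel_ideal.
Proof.
split; first exact/rel_idealP/in_ideal0.
move=> x y /rel_idealP hx /rel_idealP /(in_idealZ (-1)); rewrite scaleN1r.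
by move=> hy; apply/rel_idealP/in_idealD.
Qed.
HB.instance Definition _ :=
  GRing.isZmodClosed.Build A rel_ideal rel_ideal_zmod_closed.

Definition rel_quot : Type :=
  Quotient.quot (GRing.ZmodClosed.clone A rel_ideal _).
HB.instance Definition _ := GRing.Zmodule.on rel_quot.

Definition rq_pi : A -> rel_quot :=
  \pi_(Quotient.quot (GRing.ZmodClosed.clone A rel_ideal _)).
Definition rq_repr (u : rel_quot) : A := repr u.

Lemma rq_piP x y : rq_pi x = rq_pi y <-> in_ideal (x - y).
Proof.
split=> [/eqP|/rel_idealP].
  by rewrite -Quotient.idealrBE => /rel_idealP.
by rewrite Quotient.idealrBE => /eqP.
Qed.

Lemma rq_reprK : cancel rq_repr rq_pi.
Proof. exact: reprK. Qed.

Lemma rq_piD : {morph rq_pi : x y / x + y}.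
Proof. exact: Quotient.pi_add. Qed.

Lemma rq_piB : {morph rq_pi : x y / x - y}.
Proof. by move=> x y; apply: (addIr (rq_pi y)); rewrite -rq_piD !subrK. Qed.

Lemma rq_pi0 : rq_pi 0 = 0.
Proof. by apply: (addrI (rq_pi 0)); rewrite -rq_piD !addr0. Qed.

Definition rq_one : rel_quot := rq_pi 1.
Definition rq_mul (u v : rel_quot) : rel_quot := rq_pi (rq_repr u * rq_repr v).
Definition rq_scale (c : F) (u : rel_quot) : rel_quot := rq_pi (c *: rq_repr u).

Lemma rq_repr_pi x : in_ideal (rq_repr (rq_pi x) - x).
Proof. by apply/rq_piP; rewrite rq_reprK. Qed.

Lemma rq_pi_mul x y : rq_mul (rq_pi x) (rq_pi y) = rq_pi (x * y).
Proof.
apply/rq_piP; set x' := rq_repr _; set y' := rq_repr _.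
have -> : x' * y' - x * y = 1 * (x' - x) * y' + x * (y' - y) * 1.
  by rewrite mul1r mulr1 mulrBl mulrBr addrA subrK.
by apply: in_idealD; apply: in_idealM; apply: rq_repr_pi.
Qed.

Lemma rq_pi_scale c x : rq_scale c (rq_pi x) = rq_pi (c *: x).
Proof. by apply/rq_piP; rewrite -scalerBr; apply/in_idealZ/rq_repr_pi. Qed.

Lemma rq_mulA : associative rq_mul.
Proof.
by move=> u v w; rewrite -[u]rq_reprK -[v]rq_reprK -[w]rq_reprK
  !rq_pi_mul mulrA.
Qed.
Lemma rq_mul1r : left_id rq_one rq_mul.
Proof. by move=> u; rewrite -[u]rq_reprK rq_pi_mul mul1r. Qed.
Lemma rq_mulr1 : right_id rq_one rq_mul.
Proof. by move=> u; rewrite -[u]rq_reprK rq_pi_mul mulr1. Qed.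
Lemma rq_mulDl : left_distributive rq_mul +%R.
Proof.
by move=> u v w; rewrite -[u]rq_reprK -[v]rq_reprK -[w]rq_reprK
  -rq_piD !rq_pi_mul -rq_piD mulrDl.
Qed.
Lemma rq_mulDr : right_distributive rq_mul +%R.
Proof.
by move=> u v w; rewrite -[u]rq_reprK -[v]rq_reprK -[w]rq_reprK
  -rq_piD !rq_pi_mul -rq_piD mulrDr.
Qed.
Lemma rq_one_neq0 : ~ in_ideal 1 -> rq_one != 0.
Proof.
move=> h1; rewrite -rq_pi0.
by apply/eqP => /rq_piP; rewrite subr0.
Qed.

Lemma rq_scaleA a b (u : rel_quot) :
  rq_scale a (rq_scale b u) = rq_scale (a * b) u.
Proof. by rewrite -[u]rq_reprK !rq_pi_scale scalerA. Qed.
Lemma rq_scale1 : left_id 1 rq_scale.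
Proof. by move=> u; rewrite -[u]rq_reprK rq_pi_scale scale1r. Qed.
Lemma rq_scaleDr : right_distributive rq_scale +%R.
Proof.
by move=> c u v; rewrite -[u]rq_reprK -[v]rq_reprK -rq_piD !rq_pi_scale
  -rq_piD scalerDr.
Qed.
Lemma rq_scaleDl (u : rel_quot) : {morph rq_scale^~ u : a b / a + b}.
Proof. by move=> a b; rewrite -[u]rq_reprK !rq_pi_scale -rq_piD scalerDl. Qed.

Lemma rq_scaleAl c (u v : rel_quot) :
  rq_scale c (rq_mul u v) = rq_mul (rq_scale c u) v.
Proof.
by rewrite -[u]rq_reprK -[v]rq_reprK rq_pi_scale !rq_pi_mul rq_pi_scale scalerAl.
Qed.
Lemma rq_scaleAr :
  (forall c (x y : A), c *: (x * y) = x * (c *: y)) ->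
  forall c (u v : rel_quot), rq_scale c (rq_mul u v) = rq_mul u (rq_scale c v).
Proof.
move=> sAr c u v.
by rewrite -[u]rq_reprK -[v]rq_reprK rq_pi_scale !rq_pi_mul rq_pi_scale sAr.
Qed.

Lemma ideal_morph0 (B : nzRingType) (phi : {rmorphism A -> B}) x :
  (forall r, rel r -> phi r = 0) -> in_ideal x -> phi x = 0.
Proof.
move=> hr [s hs ->]; rewrite rmorph_sum big_seq big1 // => t /hs /hr e.
by rewrite !rmorphM /= e mulr0 mul0r.
Qed.

End QuotientByRelations.

Section Uq.
Variables (F : fieldType) (q : F) (n : nat).

Local Notation uq_free := {malg F[{fmonom (uq_gen n)}]}.

Definition free_gen (g : uq_gen n) : uq_free := << fmu g >>.

Definition free_rel : uq_free -> Prop :=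
  uq_rel q (fun i => free_gen (gE i)) (fun i => free_gen (gF i))
    (fun k => free_gen (gK k)) (fun k => free_gen (gKinv k)).

Lemma free_scaleAr (c : F) (x y : uq_free) : c *: (x * y) = x * (c *: y).
Proof.
suff C (z : uq_free) : z * c%:MP = c *: z.
  by rewrite -(mul_malgC c y) mulrA C scalerAl.
rewrite malgM_def fgmulgU malgZ_def /fgscale.
by apply: eq_bigr => k _; rewrite mulm1 mulrC.
Qed.

Section Eval.
Variables (B : algType F) (h : uq_gen n -> B).

Definition eval_monom (m : {fmonom (uq_gen n)}) : B :=
  \prod_(g <- (m : seq _)) h g.

Lemma eval_monom_morph : mmorphism eval_monom.
Proof.
split=> [m1 m2|]; first by rewrite /eval_monom fmM big_cat.
by rewrite /eval_monom fm1 big_nil.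
Qed.
HB.instance Definition _ :=
  monalg.isMultiplicative.Build {fmonom (uq_gen n)} B eval_monom
    eval_monom_morph.

Definition free_eval : uq_free -> B := mmap (in_alg B) eval_monom.

HB.instance Definition _ := GRing.Additive.on free_eval.
Lemma free_eval_mult : multiplicative free_eval.
Proof.
apply: commr_mmap_is_multiplicative => g m m' /=.
by rewrite /GRing.comm mulr_algl mulr_algr.
Qed.
HB.instance Definition _ :=
  GRing.isMultiplicative.Build uq_free B free_eval free_eval_mult.
Lemma free_evalZ : scalable free_eval.
Proof. by move=> c x; rewrite /free_eval mmapZ /= mulr_algl. Qed.
HB.instance Definition _ :=
  GRing.isScalable.Build F uq_free B *:%R free_eval free_evalZ.
Lemma free_eval_gen g : free_eval (free_gen g) = h g.
Proof.
by rewrite /free_eval mmapU /= scale1r mul1r /eval_monom fmU big_seq1.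
Qed.

Lemma free_eval_rel r : free_rel r ->
  uq_rel q (h \o @gE n) (h \o @gF n) (h \o @gK n) (h \o @gKinv n)
    (free_eval r).
Proof. by apply: (uq_rel_morph (phi := free_eval)) => i; apply: free_eval_gen. Qed.

End Eval.

Definition counit_gen (g : uq_gen n) : F^o :=
  match g with gE _ | gF _ => 0 | gK _ | gKinv _ => 1 end.

Lemma free_ideal1 : ~ in_ideal free_rel 1.
Proof.
have hr r : free_rel r -> free_eval counit_gen r = 0.
  by move=> /(free_eval_rel counit_gen) /uq_rel_trivial.
move=> /(ideal_morph0 (phi := free_eval counit_gen) hr) /eqP.
by rewrite rmorph1 oner_eq0.
Qed.

Definition uq : Type := rel_quot free_rel.
HB.instance Definition _ := GRing.Zmodule.on uq.
HB.instance Definition _ := GRing.Zmodule_isNzRing.Build uq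
  (@rq_mulA _ _ free_rel) (@rq_mul1r _ _ free_rel) (@rq_mulr1 _ _ free_rel)
  (@rq_mulDl _ _ free_rel) (@rq_mulDr _ _ free_rel) (rq_one_neq0 free_ideal1).
HB.instance Definition _ := GRing.Zmodule_isLmodule.Build F uq
  (@rq_scaleA _ _ free_rel) (@rq_scale1 _ _ free_rel)
  (@rq_scaleDr _ _ free_rel) (@rq_scaleDl _ _ free_rel).
HB.instance Definition _ := GRing.Lmodule_isLalgebra.Build F uq
  (@rq_scaleAl _ _ free_rel).
HB.instance Definition _ := GRing.Lalgebra_isAlgebra.Build F uq
  (rq_scaleAr free_scaleAr).

Definition uq_pi (x : uq_free) : uq := rq_pi free_rel x.

Lemma uq_pi_is_additive : additive uq_pi.
Proof.
exact: (@rq_piB _ _ free_rel).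
Qed.
Lemma uq_pi_is_multiplicative : multiplicative uq_pi.
Proof. by split; [move=> x y; exact/esym/rq_pi_mul|]. Qed.
Lemma uq_pi_is_scalable : scalable uq_pi.
Proof. by move=> c x; exact/esym/rq_pi_scale. Qed.

HB.instance Definition _ :=
  GRing.isAdditive.Build uq_free uq uq_pi uq_pi_is_additive.
HB.instance Definition _ :=
  GRing.isMultiplicative.Build uq_free uq uq_pi uq_pi_is_multiplicative.
HB.instance Definition _ :=
  GRing.isScalable.Build F uq_free uq *:%R uq_pi uq_pi_is_scalable.

Definition uq_gen_val (g : uq_gen n) : uq := uq_pi (free_gen g).

Definition uqE (i : 'I_n.-1) : uq := uq_gen_val (gE i).
Definition uqK (k : 'I_n) : uq := uq_gen_val (gK k).
Definition uqKinv (k : 'I_n) : uq := uq_gen_val (gKinv k).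

(* F_i with its index i : nat in 1..n-1; set to 0 outside that range. *)
Definition uqF (i : nat) : uq :=
  if i is i'.+1 then
    oapp (fun k : 'I_n.-1 => uq_gen_val (gF k)) 0 (insub i')
  else 0.

Lemma uqF_ord (i : 'I_n.-1) : uqF i.+1 = uq_gen_val (gF i).
Proof. by rewrite /uqF valK. Qed.

Lemma uq_relE r :
  uq_rel q uqE (fun i : 'I_n.-1 => uqF i.+1) uqK uqKinv r -> r = 0.
Proof.
move=> hr; have hF i : uq_pi (free_gen (gF i)) = uqF i.+1 by rewrite uqF_ord.
have [r0 hr0 ->] := @uq_rel_preim F q n _ uq uq_pi _ _ _ _ _ _ _ _
  (fun i => erefl (uqE i)) hF (fun k => erefl (uqK k))
  (fun k => erefl (uqKinv k)) r hr.
rewrite -(raddf0 uq_pi); apply/rq_piP; rewrite subr0.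
exact: in_ideal_rel.
Qed.

Section Lift.
Variables (B : algType F) (E Fn : 'I_n.-1 -> B) (K Ki : 'I_n -> B).
Hypothesis relB : forall r, uq_rel q E Fn K Ki r -> r = 0.

Definition lift_gen (g : uq_gen n) : B :=
  match g with gE i => E i | gF i => Fn i | gK k => K k | gKinv k => Ki k end.

Definition uq_lift (u : uq) : B := free_eval lift_gen (rq_repr u).

Lemma uq_lift_pi x : uq_lift (uq_pi x) = free_eval lift_gen x.
Proof.
have hr r : free_rel r -> free_eval lift_gen r = 0.
  by move=> hr; apply/relB/(free_eval_rel lift_gen hr).
apply/eqP; rewrite -subr_eq0 /uq_lift -(raddfB (free_eval lift_gen)).
by apply/eqP/(ideal_morph0 (phi := free_eval lift_gen) hr)/rq_repr_pi.
Qed.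

Lemma uq_lift_is_additive : additive uq_lift.
Proof.
move=> u v; rewrite -(rq_reprK u) -(rq_reprK v) -/(uq_pi _) -/(uq_pi _).
by rewrite -[X in uq_lift X](raddfB uq_pi) !uq_lift_pi raddfB.
Qed.
Lemma uq_lift_is_multiplicative : multiplicative uq_lift.
Proof.
split=> [u v|]; last by rewrite -(rmorph1 uq_pi) uq_lift_pi rmorph1.
rewrite -(rq_reprK u) -(rq_reprK v) -/(uq_pi _) -/(uq_pi _).
by rewrite -[X in uq_lift X](rmorphM uq_pi) !uq_lift_pi (free_eval_mult _).1.
Qed.
Lemma uq_lift_is_scalable : scalable uq_lift.
Proof.
move=> c u; rewrite -(rq_reprK u) -/(uq_pi _).
by rewrite -[X in uq_lift X]uq_pi_is_scalable !uq_lift_pi free_evalZ.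
Qed.
End Lift.

Lemma uq_universal (B : algType F) (E Fn : 'I_n.-1 -> B) (K Ki : 'I_n -> B) :
  (forall r, uq_rel q E Fn K Ki r -> r = 0) ->
  exists phi : {lrmorphism uq -> B},
    [/\ forall i, phi (uqE i) = E i, forall i : 'I_n.-1, phi (uqF i.+1) = Fn i,
        forall k, phi (uqK k) = K k & forall k, phi (uqKinv k) = Ki k].
Proof.
move=> relB.
pose mA := GRing.isAdditive.Build uq B _ (uq_lift_is_additive relB).
pose mM := GRing.isMultiplicative.Build uq B _ (uq_lift_is_multiplicative relB).
pose mZ := GRing.isScalable.Build F uq B *:%R _ (uq_lift_is_scalable relB).
pose phi : {lrmorphism uq -> B} := HB.pack (uq_lift E Fn K Ki) mA mM mZ.
exists phi.
by split=> i; rewrite ?uqF_ord; apply: etrans (uq_lift_pi relB _) (free_eval_gen _ _).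
Qed.

End Uq.

Section LinearNotions.
Variables (F : fieldType) (V : lmodType F).

Definition lin_indep (X : set V) : Prop :=
  forall (s : seq V) (c : V -> F), uniq s -> (forall x, x \in s -> X x) ->
  \sum_(x <- s) c x *: x = 0 -> forall x, x \in s -> c x = 0.

Definition lin_comb (X : set V) : set V :=
  [set x | exists2 s : seq (F * V), (forall p, p \in s -> X p.2) &
           x = \sum_(p <- s) p.1 *: p.2]%classic.

End LinearNotions.

(* The relation [r] restricts to (the graph of) a bijection from X onto Y. *)
Definition bij_by {A B : Type} (r : A -> B -> Prop) (X : set A) (Y : set B) :=
  [/\ forall x, X x -> exists! y, r x y,
      forall x y, X x -> r x y -> Y y
    & forall y, Y y -> exists! x, X x /\ r x y].

Section Weights.
Variable n : nat.

(* eps i = \varepsilon_i for i in 1..n; column k : 'I_n of a weight is its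
   coordinate of index k+1. *)
Definition eps (i : nat) : 'rV[int]_n := \row_(k < n) (k.+1 == i)%:Z.
Definition alpha (i : nat) : 'rV[int]_n := eps i - eps i.+1.
Definition root_sum (i j : nat) : 'rV[int]_n := \sum_(i <= k < j.+1) alpha k.

Definition pos_roots : set 'rV[int]_n :=
  [set b | exists i j,
     [/\ (1 <= i)%N, (i <= j)%N, (j <= n.-1)%N & b = root_sum i j]]%classic.
Definition neg_roots : set 'rV[int]_n := [set - b | b in pos_roots]%classic.

End Weights.

(* part lam i = lambda_i, for i >= 1, lambda being extended by zeros. *)
Definition part (lam : seq nat) (i : nat) : int := (nth 0%N lam i.-1)%:Z.

Definition part_wt (n : nat) (lam : seq nat) : 'rV[int]_n :=
  \row_(k < n) part lam k.+1.

Definition shift (T : Type) (s : nat) (f : nat -> T) : nat -> T :=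
  fun i => f (i + s)%N.

Section Psi.
Variables (F : fieldType) (q : F) (A : lalgType F).

Definition psi_c (lam : nat -> int) (m : nat) : int :=
  if m == 1%N then 0 else lam 2%N - lam m.+1 + m%:Z - 1.
Definition psi_d (lam : nat -> int) (m : nat) : int :=
  lam 1%N - lam m.+1 + m%:Z - 1.

(* psi lam f m is Psi_m formed with lambda_i = lam i and F_i = f i (i >= 1);
   hence Psi_m^{+(s)} is psi (shift s lam) (shift s f) m. *)
Fixpoint psi (lam : nat -> int) (f : nat -> A) (m : nat) : A :=
  match m with
  | 0 => 1
  | 1 => (qnum q (psi_d lam 1))^-1 *: f 1%N
  | m'.+1 =>
      let psi_plus := psi (shift 1 lam) (shift 1 f) m' in
      (qnum q (psi_d lam m))^-1 *:
        (qnum q (psi_c lam m) *: (f 1%N * psi_plus)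
         - qnum q (psi_c lam m - 1) *: (psi_plus * f 1%N))
  end.

Definition coxeter_monomial (f : nat -> A) (k : nat) (x : A) : Prop :=
  exists2 s : seq nat, perm_eq s (iota 1 k) & x = \prod_(i <- s) f i.

End Psi.

Section UqNotions.
Variables (F : fieldType) (q : F) (n : nat).
Local Notation U := (uq q n).

Definition subalgebra (S : set U) : Prop :=
  [/\ S 1, forall (a : F) x y, S x -> S y -> S (a *: x + y)
    & forall x y, S x -> S y -> S (x * y)].

Definition uq_minus : set U :=
  smallest subalgebra
    [set uqF q n i | i in [set i | (1 <= i <= n.-1)%N]]%classic.

Definition has_weight (x : U) (b : 'rV[int]_n) : Prop :=
  forall k : 'I_n, uqK q k * x * uqKinv q k = q ^ (b 0 k) *: x.

Definition neg_root_vector (x : U) : Prop :=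
  [/\ uq_minus x, x != 0 & exists2 b, neg_roots b & has_weight x b].

Definition shifted_coxeter_monomial (x : U) : Prop :=
  exists k s : nat, [/\ (1 <= k)%N, (k + s <= n.-1)%N
    & coxeter_monomial (shift s (uqF q n)) k x].

(* xi_m^lambda(v_j) = Psi_{m-j}^{+(j-1)} *)
Definition xi (lam : seq nat) (m j : nat) : U :=
  psi q (shift j.-1 (part lam)) (shift j.-1 (uqF q n)) (m - j).

Section Modules.
Variables (V : vectType F) (rho : U -> 'End(V)).

Definition weight_space (mu : 'rV[int]_n) : {vspace V} :=
  (\bigcap_(k < n) passmx.leigenspace (rho (uqK q k)) (q ^ (mu 0%R k)))%VS.

Definition uq_module : Prop :=
  [/\ forall (a : F) x y, rho (a *: x + y) = a *: rho x + rho y,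
      rho 1 = \1%VF,
      forall x y, rho (x * y) = (rho x \o rho y)%VF
    & exists s : seq 'rV[int]_n,
        [/\ uniq s, directv (\sum_(mu <- s) weight_space mu)
          & (\sum_(mu <- s) weight_space mu)%VS = fullv]].

Definition maximal_vector (mu : 'rV[int]_n) (b : V) : Prop :=
  [/\ b != 0, b \in weight_space mu & forall i, rho (uqE q i) b = 0].

Definition submodule (S : {vspace V}) : Prop :=
  forall x, (rho x @: S <= S)%VS.

Definition generated_by (b : V) (S : {vspace V}) : Prop :=
  forall v, v \in S <-> exists x, v = rho x b.

Definition simple_submodule (S : {vspace V}) : Prop :=
  [/\ submodule S, S != 0%VS
    & forall T, submodule T -> (T <= S)%VS -> T = 0%VS \/ T = S].

(* S is a copy of V_q(mu), the simple module of highest weight mu. *)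
Definition copy_of_Vq (mu : 'rV[int]_n) (S : {vspace V}) : Prop :=
  simple_submodule S /\ exists2 v, v \in S & maximal_vector mu v.

End Modules.
End UqNotions.

(* Main.v *)
(* In the natural representation F_i acts as the matrix unit e_{i+1,i}, so the
   only Coxeter monomial in F_j, ..., F_{m-1} acting nontrivially is
   F_{m-1} ... F_j.  Its coefficient in xi_m(v_j) is, up to sign, a product of
   1/[d_1] and factors [c_k - 1]/[d_k], taken at shifted partitions, all nonzero
   because lambda is regular.  Hence xi_m(v_j) is nonzero, and everything else follows
   from weights: the xi_m(v_j), and likewise the nonzero xi_m(v_j) b, are joint
   eigenvectors of the K_i with pairwise distinct weights, q not being a root
   of unity. *)
Require Import Defs.
From mathcomp Require Import all_boot all_order all_algebra.
From mathcomp Require Import boolp classical_sets.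
From mathcomp Require Import zify.

Set Implicit Arguments.
Unset Strict Implicit.
Unset Printing Implicit Defensive.
Import Order.TTheory GRing.Theory Num.Theory.
Local Open Scope ring_scope.
Local Open Scope classical_set_scope.

(** * Powers of [q], quantum integers, and joint eigenvectors with eigenvalues powers of [q] *)

Section NotRootOfUnity.
Variables (F : fieldType) (q : F).
Hypotheses (q_neq0 : q != 0)
  (q_not_root : forall m : nat, (0 < m)%N -> q ^+ m != 1).

(** If two powers agree, the quotient [q ^ (a - b)] is 1; after inverting when [a - b] is negative,
    this is a positive power of [q] equal to 1 unless [a = b]. *)
Lemma exprz_inj_not_root : injective (fun a : int => q ^ a).
Proof.
move=> a b /= eab; apply/eqP; rewrite -subr_eq0.
have e1 : q ^ (a - b) = 1 by rewrite expfzDr // eab -expfzDr // subrr.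
case: (a - b) e1 => m e1; last first.
  move: e1; rewrite NegzE -invr_expz => /(congr1 GRing.inv).
  by rewrite invrK invr1 => /eqP; rewrite (negPf (q_not_root _)).
by case: m e1 => // m /eqP; rewrite (negPf (q_not_root _)).
Qed.

Lemma qnum_denom_neq0 : q - q^-1 != 0.
Proof.
rewrite subr_eq0; apply/eqP => e.
by have /(_ 1 (-1) e) := exprz_inj_not_root.
Qed.

Lemma qnum_neq0 (m : int) : m != 0 -> qnum q m != 0.
Proof.
move=> m0; rewrite mulf_neq0 ?invr_eq0 ?qnum_denom_neq0 // subr_eq0.
by apply: contra m0 => /eqP/exprz_inj_not_root; lia.
Qed.

Section JointEigenvectors.
Variables (n : nat) (V : lmodType F) (T : 'I_n -> {linear V -> V}).

(** The operators are arbitrary so that [T] can be conjugation by the K_i on the algebra or the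
    action of the K_i on a module. The zero vector qualifies for every [mu]. *)
Definition joint_eigenvector (x : V) (mu : 'rV[int]_n) : Prop :=
  forall k : 'I_n, T k x = q ^ (mu 0 k) *: x.

Lemma joint_eigenvector_inj (x : V) (mu nu : 'rV[int]_n) :
  x != 0 -> joint_eigenvector x mu -> joint_eigenvector x nu -> mu = nu.
Proof.
move=> x0 hmu hnu; apply/rowP => k; apply: exprz_inj_not_root => /=.
apply/eqP; rewrite -subr_eq0; have := hmu k.
rewrite hnu => /eqP; rewrite eq_sym -subr_eq0 -scalerBl scaler_eq0.
by rewrite (negPf x0) orbF.
Qed.

(* Applying [T k - q ^ (mu 0 k)], with mu the eigenvalue of x, to a relation
   removes x from it. *)
Lemma lin_indep_joint_eigenvectors (X : set V) (w : V -> 'rV[int]_n) :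
  (forall x, X x -> x != 0) ->
  (forall x, X x -> joint_eigenvector x (w x)) ->
  (forall x y, X x -> X y -> w x = w y -> x = y) ->
  lin_indep X.
Proof.
move=> X0 Xw w_inj s; elim: s => // x s IH c /= /andP[xs us] hX e0.
have hXs y : y \in s -> X y by move=> ys; apply: hX; rewrite inE ys orbT.
have Xx : X x by apply: hX; rewrite inE eqxx.
rewrite big_cons in e0.
have cs y : y \in s -> c y = 0.
  move=> ys; have : w x != w y.
    by apply: contra xs => /eqP/w_inj -> //; apply: hXs.
  move=> /eqP wxy; have [k wk] : exists k, w x 0 k <> w y 0 k.
    by apply: contrapT => /forallNP h; apply/wxy/rowP => k; apply: contrapT.
  pose c' z := c z * (q ^ (w z 0 k) - q ^ (w x 0 k)).
  have : \sum_(z <- s) c' z *: z = 0.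
    have /= := congr1 (fun z => T k z - q ^ (w x 0 k) *: z) e0.
    rewrite linear0 scaler0 subr0 linearD linear_sum linearZ /= Xw //.
    rewrite scalerDr scaler_sumr !scalerA mulrC.
    rewrite opprD addrACA subrr add0r -sumrB; apply: etrans.
    apply: eq_big_seq => z /hXs Xz.
    rewrite linearZ /= Xw // !scalerA -scalerBl /c' mulrBr.
    by rewrite [_ ^ w x 0 k * _]mulrC.
  move=> /(IH _ us hXs)/(_ y ys)/eqP; rewrite mulf_eq0 subr_eq0.
  case/orP=> /eqP // /exprz_inj_not_root e; by case: wk.
move=> y; rewrite inE => /orP[/eqP -> |]; last exact: cs.
move: e0; rewrite big_seq big1 ?addr0; last by move=> z /cs ->; rewrite scale0r.
by move=> /eqP; rewrite scaler_eq0 (negPf (X0 _ Xx)) orbF => /eqP.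
Qed.

(** Common core of (a) and (b). A nonzero vector determines its weight, and distinct indices have
    distinct weights, so a weight determines the index and hence the vector. *)
Lemma joint_eigenvector_family (I : Type) (P : I -> Prop) (g : I -> V)
    (w : I -> 'rV[int]_n) :
  (forall i, P i -> joint_eigenvector (g i) (w i)) ->
  (forall i j, P i -> P j -> w i = w j -> i = j) ->
  let X := [set x | (exists2 i, P i & x = g i) /\ x != 0] in
  lin_indep X /\
  bij_by joint_eigenvector X [set w i | i in [set i | P i /\ g i != 0]].
Proof.
move=> gw w_inj X.
have X_w x : X x -> exists mu, joint_eigenvector x mu.
  by case=> -[i Pi ->] _; exists (w i); apply: gw.
have uniqX x y mu : X x -> X y ->
    joint_eigenvector x mu -> joint_eigenvector y mu -> x = y.
  move=> [[i Pi ->] gi0] [[j Pj ->] gj0] hi hj; congr g; apply: w_inj => //.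
  rewrite (joint_eigenvector_inj gi0 (gw _ Pi) hi).
  by rewrite (joint_eigenvector_inj gj0 (gw _ Pj) hj).
split.
  (* Independence needs the weight as a function of the vector, while [w] is a function of the
     index; the default 0 is never taken on [X], by [X_w]. *)
  pose f x := xget 0 [set mu | joint_eigenvector x mu].
  have hf x : X x -> joint_eigenvector x (f x) by move=> /X_w/xgetPex; apply.
  apply: (@lin_indep_joint_eigenvectors X f) => // [x []//|x y Xx Xy e].
  by apply: (uniqX x y (f x)) => //; [exact: hf|rewrite e; exact: hf].
split=> [x Xx|x mu [[i Pi ->] gi0] hx|_ [i [Pi gi0] <-]].
- have [mu hmu] := X_w x Xx; exists mu; split=> // nu.
  by apply: joint_eigenvector_inj hmu; case: Xx.
- by exists i => //; apply: joint_eigenvector_inj (gw i Pi) hx.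
have Xg : X (g i) by split=> //; exists i.
exists (g i); split=> [|y [Xy hy]]; first by split=> //; apply: gw.
exact: uniqX (gw i Pi) hy.
Qed.

End JointEigenvectors.
End NotRootOfUnity.

(** * Formal properties of the recursion for Psi_m *)

Lemma psiSS (F : fieldType) (q : F) (A : lalgType F) (lam : nat -> int)
    (f : nat -> A) (m : nat) :
  psi q lam f m.+2 =
  (qnum q (psi_d lam m.+2))^-1 *:
    (qnum q (psi_c lam m.+2) *: (f 1%N * psi q (shift 1 lam) (shift 1 f) m.+1)
     - qnum q (psi_c lam m.+2 - 1) *:
         (psi q (shift 1 lam) (shift 1 f) m.+1 * f 1%N)).
Proof. by []. Qed.

Lemma rmorph_psi (F : fieldType) (q : F) (A B : lalgType F)
    (phi : {rmorphism A -> B}) (lam : nat -> int) (f : nat -> A) (m : nat) :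
  (forall (c : F) (x : A), phi (c *: x) = c *: phi x) ->
  phi (psi q lam f m) = psi q lam (phi \o f) m.
Proof.
move=> phiZ; elim: m lam f => [|[|m] IH] lam f; first exact: rmorph1.
  by rewrite /= phiZ.
by rewrite !psiSS phiZ rmorphB !phiZ !rmorphM IH.
Qed.

Lemma psi_subalgebra (F : fieldType) (q : F) (n : nat) (S : set (uq q n))
    (lam : nat -> int) (f : nat -> uq q n) (m : nat) :
  subalgebra S -> (forall i, (1 <= i <= m)%N -> S (f i)) -> S (psi q lam f m).
Proof.
move=> [S1 SL SM].
have S0 : S 0 by rewrite -(addNr 1) -scaleN1r; apply: SL.
have SZ a x : S x -> S (a *: x) by rewrite -[_ *: _]addr0 => Sx; apply: SL.
elim: m lam f => [|[|m] IH] lam f Sf; first exact: S1.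
  by apply: SZ; apply: Sf.
have Sf1 : S (f 1%N) by apply: Sf.
have Sp : S (psi q (shift 1 lam) (shift 1 f) m.+1).
  by apply: IH => i im; apply: Sf; lia.
rewrite psiSS -scaleNr; apply/SZ/SL; first exact: SM.
by apply/SZ/SM.
Qed.

(** * Linear combinations, expansion into Coxeter monomials, and evaluation at matrix units *)

Section LinearCombinations.
Variables (F : fieldType) (V : lmodType F).
Implicit Types X Y : set V.

Lemma lin_combD X x y : lin_comb X x -> lin_comb X y -> lin_comb X (x + y).
Proof.
move=> [s hs ->] [t ht ->]; exists (s ++ t); last by rewrite big_cat.
by move=> p; rewrite mem_cat => /orP[/hs|/ht].
Qed.

(** Used with [h] a left or right multiplication in the recursion, and with [h] the identity to
    enlarge the spanning set. *)
Lemma lin_comb_linear X Y (h : {linear V -> V}) (x : V) :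
  (forall y, X y -> Y (h y)) -> lin_comb X x -> lin_comb Y (h x).
Proof.
move=> XY [s hs ->]; exists [seq (p.1, h p.2) | p <- s].
  by move=> _ /mapP[p /hs ? ->]; apply: XY.
by rewrite linear_sum big_map; apply: eq_bigr => p _; rewrite linearZ.
Qed.

Lemma lin_combZ X a x : lin_comb X x -> lin_comb X (a *: x).
Proof.
move=> [s hs ->]; exists [seq (a * p.1, p.2) | p <- s].
  by move=> _ /mapP[p /hs ? ->].
by rewrite scaler_sumr big_map; apply: eq_bigr => p _; rewrite scalerA.
Qed.

End LinearCombinations.

Lemma perm_iota_cons (m : nat) (s : seq nat) :
  perm_eq s (iota 1 m) ->
  perm_eq (1%N :: [seq (i + 1)%N | i <- s]) (iota 1 m.+1).
Proof.
move=> sm; rewrite /= perm_cons (iotaDl 1 1).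
by under eq_map => i do rewrite addnC; rewrite perm_map.
Qed.

(** By induction [psi_plus] is a combination of Coxeter monomials in [f 2], ..., [f m]; the
    recursion puts [f 1] in front of them or behind them, so each letter still occurs once. *)
Lemma psi_coxeter (F : fieldType) (q : F) (A : algType F) (lam : nat -> int)
    (f : nat -> A) (m : nat) :
  lin_comb (coxeter_monomial f m) (psi q lam f m).
Proof.
elim: m lam f => [|[|m] IH] lam f.
- exists [:: (1, 1)]; last by rewrite big_seq1 scale1r.
  by move=> p; rewrite inE => /eqP ->; exists [::]; rewrite ?big_nil.
- apply: lin_combZ; exists [:: (1, f 1%N)]; last by rewrite big_seq1 scale1r.
  by move=> p; rewrite inE => /eqP ->; exists [:: 1%N]; rewrite ?big_seq1.
rewrite psiSS -scaleNr; apply/lin_combZ/lin_combD; apply: lin_combZ.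
  apply: (@lin_comb_linear _ _ _ _ (f 1%N \*o idfun) _ _ (IH _ _)).
  move=> _ [s hs ->]; exists (1%N :: [seq (i + 1)%N | i <- s]).
    exact: perm_iota_cons.
  by rewrite big_cons big_map.
apply: (@lin_comb_linear _ _ _ _ (f 1%N \o* idfun) _ _ (IH _ _)).
move=> _ [s hs ->]; exists (rcons [seq (i + 1)%N | i <- s] 1%N).
  by rewrite perm_rcons; apply: perm_iota_cons.
by rewrite -cats1 big_cat big_seq1 big_map.
Qed.

(** Of the two terms of the recursion only [psi_plus * f 1] survives, contributing the factor
    -[c_m - 1]/[d_m]; both integers are positive because [lam] strictly decreases. The family [e] is
    abstract so that the induction can shift its indices. *)
Lemma psi_matrix_units (F : fieldType) (q : F) (A : algType F)
    (lam : nat -> int) (f : nat -> A) (e : nat -> nat -> A) (m : nat) :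
  (forall k, k != 0 -> qnum q k != 0) ->
  (forall i j, (1 <= i < j)%N -> (j <= m.+1)%N -> lam j < lam i) ->
  (forall i, (1 <= i <= m)%N -> f i = e i.+1 i) ->
  (forall i j k l, (1 <= j <= m.+1)%N ->
     e i j * e k l = (j == k)%:R *: e i l) ->
  (1 <= m)%N -> exists2 a, a != 0 & psi q lam f m = a *: e m.+1 1%N.
Proof.
move=> qn0; elim: m lam f e => [//|[|m] IH] lam f e hlam hf he _.
  exists (qnum q (psi_d lam 1))^-1; last by rewrite /= hf.
  rewrite invr_eq0; apply: qn0; rewrite /psi_d.
  by have := hlam 1%N 2%N isT isT; lia.
have [||||a a0 ea] := IH (shift 1 lam) (shift 1 f)
  (fun i j => e (i + 1)%N (j + 1)%N).
- by move=> i j *; apply: hlam; lia.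
- by move=> i im; rewrite /shift hf ?addSn //; lia.
- by move=> i j k l hj; rewrite he ?eqn_add2r //; lia.
- by [].
exists (- ((qnum q (psi_d lam m.+2))^-1 * qnum q (psi_c lam m.+2 - 1) * a)).
  rewrite oppr_eq0 2?mulf_neq0 // ?invr_eq0; apply: qn0.
    by have := hlam 1%N m.+3 isT (leqnn _); rewrite /psi_d; lia.
  by have := hlam 2%N m.+3 isT (leqnn _); rewrite /psi_c /=; lia.
(* The survivor is e_{m+3,2} e_{2,1} = e_{m+3,1}; in the other order e_{2,1} e_{m+3,2} = 0. *)
rewrite psiSS ea hf // -scalerAl he; last by lia.
rewrite -scalerAr he // addn1 /= scale0r !scaler0 sub0r.
by rewrite scale1r scalerN !scalerA scaleNr !mulrA.
Qed.

(** * The natural representation by matrices *)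

Section NaturalRepresentation.
Variables (F : fieldType) (q : F) (n : nat).
Hypotheses (q_neq0 : q != 0) (q_denom_neq0 : q - q^-1 != 0).
Local Notation M := 'M[F]_n.+1.

(* Rows and columns are numbered from 1, as the generators are. *)
Definition mat_unit (i j : nat) : M :=
  \matrix_(a, b) ((a.+1 == i) && (b.+1 == j))%:R.

(** The bound on [j] matters: outside it both factors vanish when [j = k], although [mat_unit i l]
    may not. *)
Lemma mat_unitM (i j k l : nat) : (1 <= j <= n.+1)%N ->
  mat_unit i j * mat_unit k l = (j == k)%:R *: mat_unit i l.
Proof.
case: j => // j ltj; apply/matrixP => a b; rewrite !mxE.
rewrite (bigD1 (Ordinal ltj)) //= big1 ?addr0 => [|c cj]; last first.
  have {}cj : (c.+1 == j.+1) = false by rewrite eqSS; apply/negbTE.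
  by rewrite !mxE cj andbF mul0r.
by rewrite !mxE /= eqxx andbT -!natrM !mulnb andbCA.
Qed.

Lemma mat_unitM0 (i j k l : nat) : j != k -> mat_unit i j * mat_unit k l = 0.
Proof.
move=> jk; apply/matrixP => a b; rewrite !mxE big1 // => c _.
rewrite !mxE -natrM mulnb; case: eqP => //= _; case: eqP => //= cj.
by rewrite cj (negPf jk).
Qed.

(** The sign [s = 1] gives K_k and [s = -1] its inverse, so [mat_torusM] handles all products of
    them. *)
Definition mat_torus (s : int) (k : 'I_n.+1) : M :=
  diag_mx (\row_a q ^ (s * (a == k)%:Z)).

Lemma mat_torusM (s t : int) (k l : 'I_n.+1) :
  mat_torus s k * mat_torus t l =
  diag_mx (\row_a (q ^ (s * (a == k)%:Z + t * (a == l)%:Z))).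
Proof.
rewrite -[_ * _]/(_ *m _) mulmx_diag; congr diag_mx; apply/rowP => a.
by rewrite !mxE expfzDr.
Qed.

(** With [uq_universal] this yields a morphism from [uq] to matrices, in which [xi] can be tested
    for being nonzero. *)
Lemma natural_rep_relations r :
  uq_rel q (fun i : 'I_n.+1.-1 => mat_unit i.+1 i.+2)
    (fun i => mat_unit i.+2 i.+1) (mat_torus 1) (mat_torus (-1)) r -> r = 0.
Proof.
case=> [i j|i|i|i j k l hk hl|i j|i j|i j hij|i j hij|i j hij|i j hij].
- apply/eqP; rewrite subr_eq0 !mat_torusM; apply/eqP; congr diag_mx.
  by apply/rowP => a; rewrite !mxE addrC.
- rewrite mat_torusM (_ : \row_ _ _ = const_mx 1) ?diag_const_mx ?subrr //.
  by apply/rowP => a; rewrite !mxE mul1r mulN1r subrr expr0z.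
- rewrite mat_torusM (_ : \row_ _ _ = const_mx 1) ?diag_const_mx ?subrr //.
  by apply/rowP => a; rewrite !mxE mul1r mulN1r addNr expr0z.
(* All terms vanish unless [i = j]. In that case entries are compared: off the diagonal all are 0,
   and on it the positions [i], [i.+1] and the remaining ones are treated separately. *)
- have /= := ltn_ord i; have /= := ltn_ord j => jn iN.
  rewrite !mat_unitM; [|lia|lia].
  rewrite !eqSS [(j == i :> nat)]eq_sym -val_eqE /=.
  case: (eqVneq (i : nat) j) => [<-|_]; last first.
    by rewrite mul0r !scale0r !subr0.
  rewrite !scale1r !mat_torusM mul1r; apply/matrixP => a b; rewrite !mxE.
  rewrite !mul1r !mulN1r !eqSS -!val_eqE /= hk hl.
  case: (eqVneq (a : nat) b) => [<-|ab]; last first.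
    have h m : (a == m :> nat) && (b == m :> nat) = false.
      by apply/negP => /andP[/eqP am /eqP bm]; rewrite am bm eqxx in ab.
    by rewrite !h !mulr0n subrr mulr0 subrr.
  rewrite !andbb !mulr1n.
  case: (eqVneq (a : nat) i) => [->|_].
    rewrite ltn_eqF // -[LHS]/(1 - 0 - (q - q^-1)^-1 * (q - q^-1)).
    by rewrite subr0 mulVf // subrr.
  case: (a == i.+1 :> nat).
    rewrite -[LHS]/(0 - 1 - (q - q^-1)^-1 * (q^-1 - q)).
    by rewrite sub0r -[q^-1 - q]opprB mulrN mulVf // opprK addNr.
  rewrite -[LHS]/(0 - 0 - (q - q^-1)^-1 * (1 - 1)).
  by rewrite !subrr mulr0 subr0.
(* Only the entry at row [j], column [j.+1] (counted from 0) can be nonzero, and there the powers of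
   [q] on the two sides agree. *)
- apply/matrixP => a b; rewrite -!mulmxE mul_diag_mx mul_mx_diag !mxE.
  rewrite !eqSS -!val_eqE /= !mul1r; case: (eqVneq (a : nat) j) => [->|_] /=.
    case: (eqVneq (b : nat) j.+1) => [->|_] /=.
      by rewrite mulr1 mul1r -expfzDr // ![_ == i :> nat]eq_sym subrK subrr.
    by rewrite !(mulr0, mul0r) subrr.
  by rewrite !(mulr0, mul0r) subrr.
- apply/matrixP => a b; rewrite -!mulmxE mul_diag_mx mul_mx_diag !mxE.
  rewrite !eqSS -!val_eqE /= !mul1r; case: (eqVneq (a : nat) j.+1) => [->|_] /=.
    case: (eqVneq (b : nat) j) => [->|_] /=.
      rewrite mulr1 mul1r -expfzDr // ![_ == i :> nat]eq_sym opprB subrK.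
      by rewrite subrr.
    by rewrite !(mulr0, mul0r) subrr.
  by rewrite !(mulr0, mul0r) subrr.
(* The outer terms contain the square of a matrix unit off the diagonal, which is 0; in the middle
   term one of the two adjacent products vanishes, which one depending on whether [i = j + 1] or
   [j = i + 1]. *)
- rewrite expr2 mat_unitM0 ?mul0r ?mulr0 ?add0r ?addr0; last lia.
  case/orP: hij => /eqP hij.
    by rewrite mat_unitM0 ?(mul0r, scaler0, oppr0) //; lia.
  by rewrite -mulrA [X in _ * X]mat_unitM0 ?(mulr0, scaler0, oppr0) //; lia.
- by rewrite !mat_unitM0 ?subrr //; lia.
- rewrite expr2 mat_unitM0 ?mul0r ?mulr0 ?add0r ?addr0; last lia.
  case/orP: hij => /eqP hij.
    by rewrite -mulrA [X in _ * X]mat_unitM0 ?(mulr0, scaler0, oppr0) //; lia.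
  by rewrite mat_unitM0 ?(mul0r, scaler0, oppr0) //; lia.
- by rewrite !mat_unitM0 ?subrr //; lia.
Qed.
End NaturalRepresentation.

(** * Roots as differences of standard basis vectors *)

Section Roots.
Variable n : nat.

Lemma root_sumE (i j : nat) : (i <= j.+1)%N ->
  root_sum n i j = eps n i - eps n j.+1.
Proof.
move=> ij; rewrite /root_sum -[RHS]opprB -telescope_sumr // -sumrN.
by apply: eq_bigr => k _; rewrite opprB.
Qed.

Lemma root_sum_inj (i j i' j' : nat) :
  (1 <= i <= j)%N -> (1 <= i' <= j')%N -> (j < n)%N -> (j' < n)%N ->
  root_sum n i j = root_sum n i' j' -> i = i' /\ j = j'.
Proof.
move=> hi hi' hj hj'; rewrite !root_sumE; [|lia|lia].
move=> /rowP e; have lti : (i.-1 < n)%N by lia.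
(* Coordinate [i] of the first root is 1, which forces [i' = i]; coordinate [j + 1] is -1, which
   forces [j' = j]. *)
have := e (Ordinal lti); have := e (Ordinal hj); rewrite !mxE /=.
lia.
Qed.

End Roots.

(* Stated in an arbitrary algebra, since rewriting with the ring laws directly
   in [uq q n] makes unification unfold the quotient construction. *)
Section ConjugationEigenvectors.
Variables (F : fieldType) (A : algType F) (k k' : A).
Hypothesis k'k : k' * k = 1.

Lemma conj_eigenM (x y : A) (a b : F) :
  k * x * k' = a *: x -> k * y * k' = b *: y ->
  k * (x * y) * k' = (a * b) *: (x * y).
Proof.
move=> hx hy; have -> : k * (x * y) * k' = (k * x * k') * (k * y * k').
  by rewrite !mulrA -[k * x * k' * k]mulrA k'k mulr1.
by rewrite hx hy -scalerAl -scalerAr scalerA.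
Qed.

Lemma conj_eigenB (x y : A) (a : F) :
  k * x * k' = a *: x -> k * y * k' = a *: y ->
  k * (x - y) * k' = a *: (x - y).
Proof. by move=> hx hy; rewrite mulrBr mulrBl hx hy scalerBr. Qed.

Lemma conj_eigenZ (x : A) (a c : F) :
  k * x * k' = a *: x -> k * (c *: x) * k' = a *: (c *: x).
Proof. by move=> hx; rewrite -scalerAr -scalerAl hx !scalerA mulrC. Qed.

Lemma conj_eigen_comm (x : A) (a : F) :
  k * x * k' = a *: x -> k * x = a *: (x * k).
Proof. by move=> hx; rewrite scalerAl -hx -[RHS]mulrA k'k mulr1. Qed.

End ConjugationEigenvectors.

(** * Weights in the quantum group, and the weight and monomials of [xi] *)

Section Weights.
Variables (F : fieldType) (q : F) (n : nat).
Local Notation U := (uq q n).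
Implicit Types (x y : U) (b c : 'rV[int]_n).

Lemma uqKinv_K (k : 'I_n) : uqKinv q k * uqK q k = 1.
Proof. by apply/eqP; rewrite -subr_eq0; apply/eqP/uq_relE/uq_KinvK. Qed.

Lemma uqK_Kinv (k : 'I_n) : uqK q k * uqKinv q k = 1.
Proof. by apply/eqP; rewrite -subr_eq0; apply/eqP/uq_relE/uq_KKinv. Qed.

Hypothesis q_neq0 : q != 0.

Lemma has_weight1 : has_weight (1 : U) 0.
Proof. by move=> k; rewrite mulr1 uqK_Kinv mxE expr0z scale1r. Qed.

Lemma has_weightM x y b c :
  has_weight x b -> has_weight y c -> has_weight (x * y) (b + c).
Proof.
move=> hx hy k; rewrite mxE expfzDr //.
exact: (@conj_eigenM F (uq q n) _ _ (uqKinv_K k) _ _ _ _ (hx k) (hy k)).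
Qed.

Lemma has_weightZ a x b : has_weight x b -> has_weight (a *: x) b.
Proof. by move=> hx k; exact: (@conj_eigenZ F (uq q n) _ _ _ _ _ (hx k)). Qed.

Lemma has_weightB x y b :
  has_weight x b -> has_weight y b -> has_weight (x - y) b.
Proof.
by move=> hx hy k; exact: (@conj_eigenB F (uq q n) _ _ _ _ _ (hx k) (hy k)).
Qed.

Lemma has_weight_uqF (i : nat) : has_weight (uqF q n i) (- alpha n i).
Proof.
(* Outside 1..n-1 [uqF] is 0, which has every weight; so the claim holds for all [i], in the form
   [has_weight_psi] asks for. *)
have h0 b : has_weight (0 : U) b by move=> k; rewrite mulr0 mul0r scaler0.
case: i => [|i]; first exact: h0.
have [ltin|] := ltnP i n.-1; last first.
  by move=> ni; rewrite /uqF insubN -?leqNgt //; apply: h0.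
rewrite -[i]/(Ordinal ltin : nat) => k.
have /uq_relE/eqP := @uq_KF F q n U (@uqE F q n)
  (fun i : 'I_n.-1 => uqF q n i.+1) (@uqK F q n) (@uqKinv F q n) k
  (Ordinal ltin).
rewrite subr_eq0 => /eqP ->.
by rewrite -scalerAl -mulrA uqK_Kinv mulr1 !mxE.
Qed.

(** Weights add under products, and the two terms of the recursion have the same factors in opposite
    orders. *)
Lemma has_weight_psi (lam : nat -> int) (f : nat -> U) (w : nat -> 'rV[int]_n)
    (m : nat) :
  (forall i, has_weight (f i) (w i)) ->
  has_weight (psi q lam f m) (\sum_(1 <= i < m.+1) w i).
Proof.
elim: m lam f w => [|[|m] IH] lam f w hf.
- by rewrite big_geq //; apply: has_weight1.
- by rewrite big_nat1; apply: has_weightZ.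
have hp := IH (shift 1 lam) (shift 1 f) (shift 1 w) (fun i => hf (i + 1)%N).
have -> : \sum_(1 <= i < m.+3) w i = w 1%N + \sum_(1 <= i < m.+2) shift 1 w i.
  rewrite big_nat_recl //; congr (_ + _).
  by apply: eq_bigr => i _; rewrite /shift addn1.
rewrite psiSS; apply/has_weightZ/has_weightB; apply: has_weightZ.
  exact: has_weightM (hf 1%N) hp.
by rewrite addrC; exact: has_weightM hp (hf 1%N).
Qed.

Lemma has_weight_xi (lam : seq nat) (m j : nat) : (1 <= j <= m.-1)%N ->
  has_weight (xi q n lam m j) (- root_sum n j m.-1).
Proof.
move=> hj; have := @has_weight_psi (shift j.-1 (part lam))
  (shift j.-1 (uqF q n)) (shift j.-1 (fun i => - alpha n i)) (m - j)
  (fun i => has_weight_uqF _).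
suff -> : \sum_(1 <= i < (m - j).+1) shift j.-1 (fun i => - alpha n i) i
    = - root_sum n j m.-1 by [].
(* Writing [j] as [1 + j.-1] lets [big_addn] move the shift into the index. *)
have -> : root_sum n j m.-1 = root_sum n (1 + j.-1) m.-1 by congr root_sum; lia.
rewrite /root_sum big_addn -sumrN.
by have -> : (m.-1.+1 - j.-1 = (m - j).+1)%N by lia.
Qed.

Lemma xi_uq_minus (lam : seq nat) (m j : nat) :
  (1 <= j <= m.-1)%N -> (m <= n)%N ->
  uq_minus (xi q n lam m j).
Proof.
move=> hj hm S [salg gen]; apply: psi_subalgebra => // i hi; apply: gen.
by exists (i + j.-1)%N => //=; lia.
Qed.

Lemma xi_shifted_coxeter (lam : seq nat) (m j : nat) :
  (1 <= j <= m.-1)%N -> (m <= n)%N ->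
  lin_comb (@shifted_coxeter_monomial F q n) (xi q n lam m j).
Proof.
move=> hj hm; apply: (@lin_comb_linear _ _ _ _ idfun _ _ (psi_coxeter _ _ _ _)).
by move=> x hx; exists (m - j)%N, j.-1; split=> //; lia.
Qed.

End Weights.

(** * Strict decrease of a regular partition, and nonvanishing of [xi] *)

Lemma part_gt (n : nat) (lam : seq nat) (i j : nat) :
  sorted geq lam ->
  (forall j : nat, (1 <= j <= n.-1)%N -> part lam j - part lam j.+1 != 0) ->
  (1 <= i < j)%N -> (j <= n)%N -> part lam j < part lam i.
Proof.
move=> lam_sorted lam_regular hij hj.
have le_part k l : (k <= l)%N -> part lam l.+1 <= part lam k.+1.
  move=> kl; rewrite /part /=; have [lt_l|le_l] := ltnP l (size lam).
    rewrite lez_nat; apply: (sorted_leq_nth _ _ 0%N lam_sorted) => //.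
    - by move=> a b c /= ba ac; apply: leq_trans ac ba.
    - by move=> a /=.
    - exact: leq_ltn_trans lt_l.
  by rewrite [nth _ _ l]nth_default.
case: i hij => // i hij.
(* The first step down from [i] is strict by regularity; the rest, down to [j], is weak by
   sortedness. *)
have := le_part i i.+1 (leqnSn _); have := lam_regular i.+1.
by have := le_part i.+1 j.-1; rewrite (ltn_predK (m := i.+1)); lia.
Qed.

Lemma xi_neq0 (F : fieldType) (q : F) (n : nat) (lam : seq nat) (m j : nat) :
  q != 0 -> (forall k, (0 < k)%N -> q ^+ k != 1) ->
  sorted geq lam ->
  (forall j : nat, (1 <= j <= n.-1)%N -> part lam j - part lam j.+1 != 0) ->
  (1 <= j <= m.-1)%N -> (m <= n)%N -> xi q n lam m j != 0.
Proof.
move=> q0 qroot lam_sorted lam_regular hj hm.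
(* Square matrices form a ring with 1 different from 0 only in positive size. *)
case: n lam_regular hm => [|n] lam_regular hm; first by lia.
have qd := qnum_denom_neq0 q0 qroot.
have [phi [_ phiF _ _]] := uq_universal (natural_rep_relations q0 qd (n := n)).
have phiZ (c : F) (x : uq q n.+1) : phi (c *: x) = c *: phi x by exact: linearZ.
(* Shifting by [j.-1] matches the shift in [xi]: the corner e_{m-j+1,1} becomes the matrix unit at
   (m, j), whose entry is read off below. *)
pose e a b := mat_unit F n (a + j.-1) (b + j.-1).
have [||||| a a0] := @psi_matrix_units F q 'M[F]_n.+1 (shift j.-1 (part lam))
    (phi \o shift j.-1 (uqF q n.+1)) e (m - j).
- exact: qnum_neq0.
- by move=> i k *; apply: (part_gt (n := n.+1)) => //; lia.
- move=> i hi; rewrite /= /shift.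
  have lt_i : ((i + j.-1).-1 < n.+1.-1)%N by lia.
  have -> : (i + j.-1 = (Ordinal lt_i).+1)%N by rewrite /=; lia.
  by rewrite phiF /e /=; congr mat_unit; lia.
- by move=> i k l o hk; rewrite /e mat_unitM ?eqn_add2r //; lia.
- lia.
rewrite -rmorph_psi // -/(xi q n.+1 lam m j) => phi_xi.
apply/eqP => xi0; move: phi_xi; rewrite xi0 rmorph0 => /matrixP.
have ltm : (m.-1 < n.+1)%N by lia.
have ltj : (j.-1 < n.+1)%N by lia.
move=> /(_ (Ordinal ltm) (Ordinal ltj)); rewrite !mxE /=.
rewrite (_ : _ && _ = true); last by lia.
by rewrite mulr1 => /esym/eqP; rewrite (negPf a0).
Qed.

(** * Weight vectors in modules *)

Section ModuleWeights.
Variables (F : fieldType) (q : F) (n : nat) (V : vectType F).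
Variable rho : uq q n -> 'End(V).

Lemma mem_weight_space (v : V) (mu : 'rV[int]_n) :
  v \in weight_space rho mu <->
  joint_eigenvector q (fun k => rho (uqK q k)) v mu.
Proof.
have eigenP k : v \in passmx.leigenspace (rho (uqK q k)) (q ^ (mu 0 k)) <->
    rho (uqK q k) v = q ^ (mu 0 k) *: v.
  rewrite memv_ker add_lfunE opp_lfunE scale_lfunE id_lfunE subr_eq0.
  by split=> /eqP.
rewrite memvE; split=> [/subv_bigcapP h k|h].
  by apply/eigenP; rewrite memvE; apply: h.
by apply/subv_bigcapP => k _; rewrite -memvE; apply: (eigenP k).2; apply: h.
Qed.

Hypotheses (q_neq0 : q != 0) (rho_module : uq_module rho).

(** Having weight [b] means K_k x = q^(b_k) x K_k; applied to [v], this multiplies the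
    eigenvalues. *)
Lemma has_weight_apply (x : uq q n) (v : V) (b mu : 'rV[int]_n) :
  has_weight x b -> joint_eigenvector q (fun k => rho (uqK q k)) v mu ->
  joint_eigenvector q (fun k => rho (uqK q k)) (rho x v) (mu + b).
Proof.
case: rho_module => rhoL _ rhoM _ hx hv k.
have rho0 : rho 0 = 0.
  by have := rhoL (-1) 0 0; rewrite !scaleN1r oppr0 addr0 addNr.
have rhoZ a y : rho (a *: y) = a *: rho y.
  by rewrite -[_ *: y]addr0 rhoL rho0 addr0.
have Kx := @conj_eigen_comm F (uq q n) _ _ (uqKinv_K q k) _ _ (hx k).
have rhoM' y z u : rho (y * z) u = rho y (rho z u) by rewrite rhoM comp_lfunE.
move/(_ k): hv => /= hv; rewrite -rhoM' Kx rhoZ scale_lfunE rhoM' hv linearZ /=.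
by rewrite scalerA mxE expfzDr // mulrC.
Qed.

End ModuleWeights.

Theorem theorem8p3 (F : fieldType) (q : F) (n : nat) (lam : seq nat)
    (q_neq0 : q != 0) (q_not_root : forall m : nat, (0 < m)%N -> q ^+ m != 1)
    (n_ge2 : (2 <= n)%N)
    (lam_part : sorted geq lam) (lam_size : (size lam <= n)%N)
    (lam_regular : forall j : nat, (1 <= j <= n.-1)%N ->
       part lam j - part lam j.+1 != 0) :
  (let X : set (uq q n) :=
     \bigcup_(m in [set m | (2 <= m <= n)%N])
       [set xi q n lam m j | j in [set j | (1 <= j <= m.-1)%N]] in
   [/\ lin_indep X,
       forall x, X x -> neg_root_vector x,
       forall m j : nat, (2 <= m <= n)%N -> (1 <= j <= m.-1)%N ->
         has_weight (xi q n lam m j) (- root_sum n j m.-1),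
       bij_by (@has_weight F q n) X (@neg_roots n)
     & X `<=` lin_comb (@shifted_coxeter_monomial F q n)])
  /\
  (forall (V : vectType F) (rho : uq q n -> 'End(V)) (b : V) (S : {vspace V}),
     uq_module rho ->
     maximal_vector rho (part_wt n lam) b ->
     generated_by rho b S ->
     copy_of_Vq rho (part_wt n lam) S ->
     let Y : set V :=
       \bigcup_(m in [set m | (2 <= m <= n)%N])
         [set v | (exists2 j : nat, (1 <= j <= m.-1)%N &
                    v = rho (xi q n lam m j) b) /\ v != 0] in
     [/\ lin_indep Y,
         forall v, Y v -> v \in S
       & exists2 R : set 'rV[int]_n,
           R `<=` [set part_wt n lam - a | a in @pos_roots n] &
           bij_by (fun v mu => v \in weight_space rho mu) Y R]).
Proof.
(* The union over [m] is flattened into one family indexed by the pairs [(m, j)]. *)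
pose P (i : nat * nat) := (2 <= i.1 <= n)%N /\ (1 <= i.2 <= i.1.-1)%N.
pose g (i : nat * nat) := xi q n lam i.1 i.2.
have P_weight (i : nat * nat) :
    P i -> has_weight (g i) (- root_sum n i.2 i.1.-1).
  by case=> _ hj; apply: has_weight_xi.
have root_inj i i' : P i -> P i' ->
    root_sum n i.2 i.1.-1 = root_sum n i'.2 i'.1.-1 -> i = i'.
  case: i i' => [m j] [m' j'] [/= hm hj] [/= hm' hj'] /root_sum_inj.
  by case=> *; [lia..|congr pair; lia].
have P_pos i : P i -> @pos_roots n (root_sum n i.2 i.1.-1).
  by case=> hm hj; exists i.2, i.1.-1; split=> //; lia.
split.
(* For conjugation by the K_k, being a joint eigenvector is [has_weight]. *)
- move=> X; pose conjK (k : 'I_n) : {linear uq q n -> uq q n} :=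
    uqKinv q k \o* (uqK q k \*o idfun).
  (* Here the condition [x != 0] costs nothing, by [xi_neq0]; hence all negative roots occur as
     weights in [rootsE]. *)
  have XE : X = [set x | (exists2 i, P i & x = g i) /\ x != 0].
    apply/seteqP; split=> x.
      case=> m /= hm [j /= hj <-]; split; last by apply: xi_neq0 => //; lia.
      by exists (m, j).
    by case=> -[[m j] [/= hm hj] ->] _; exists m => //; exists j.
  have [indep bij] := joint_eigenvector_family q_neq0 q_not_root (T := conjK)
    P_weight (fun i i' Pi Pi' e => root_inj i i' Pi Pi' (oppr_inj e)).
  have rootsE : [set - root_sum n i.2 i.1.-1 | i in [set i | P i /\ g i != 0]]
      = @neg_roots n.
    apply/seteqP; split=> b.
      by case=> i [Pi _] <-; exists (root_sum n i.2 i.1.-1) => //; apply: P_pos.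
    (* The root -(alpha_i + ... + alpha_j) comes from the pair [(j.+1, i)]. *)
    case=> _ [i [j [hi hij hj ->]]] <-; exists (j.+1, i) => //.
    by split; [split=> /=; lia|apply: xi_neq0 => //=; lia].
  split.
  + by rewrite XE.
  + move=> x; rewrite XE => -[[i Pi ->] gi0]; split=> //.
      by case: Pi => hm hj; apply: xi_uq_minus => //; lia.
    exists (- root_sum n i.2 i.1.-1); last exact: P_weight.
    by exists (root_sum n i.2 i.1.-1) => //; apply: P_pos.
  + by move=> m j hm hj; apply: has_weight_xi.
  + by rewrite XE -rootsE.
  + move=> x; rewrite XE => -[[i [hm hj] ->] _].
    by apply: xi_shifted_coxeter => //; lia.
move=> V rho b S rho_mod [b0 /mem_weight_space b_wt _] S_gen _ Y.
have YE : Y = [set v | (exists2 i, P i & v = rho (g i) b) /\ v != 0].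
  apply/seteqP; split=> v.
    by case=> m /= hm [[j hj ->] v0]; split=> //; exists (m, j).
  by case=> -[[m j] [/= hm hj] ->] v0; exists m => //; split=> //; exists j.
(* A vector [rho (g i) b] may vanish, so the weights obtained form only a subset; it becomes the
   witness for [R]. *)
have [|| indep bij] := joint_eigenvector_family q_neq0 q_not_root
  (T := fun k => rho (uqK q k)) (P := P) (g := fun i => rho (g i) b)
  (w := fun i => part_wt n lam - root_sum n i.2 i.1.-1).
- by move=> i Pi; apply: has_weight_apply => //; apply: P_weight.
- by move=> i i' Pi Pi' /addrI/oppr_inj; apply: root_inj.
split.
- by rewrite YE.
- by move=> v; rewrite YE => -[[i _ ->] _]; apply/S_gen; exists (g i).
have -> : (fun v mu => is_true (v \in weight_space rho mu)) =
    joint_eigenvector q (fun k => rho (uqK q k)).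
  by apply/funext => v; apply/funext => mu; apply/propext/mem_weight_space.
rewrite YE; eexists; last exact: bij.
by move=> _ [i [Pi _] <-]; exists (root_sum n i.2 i.1.-1) => //; apply: P_pos.
Qed.
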